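(* Let $G_2 := \bigoplus_{n=1}^{\infty} \mathbb{Z}/2\mathbb{Z}$. For all $\varepsilon>0$, there is a set $A\subseteq G_2$ such that $d^*(A)>\frac12-\varepsilon$, and $A-A$ does not contain a set of the form $B-B+g$, where $B\subseteq G_2$ is piecewise syndetic and $g\in G_2$.
   Context: Let $G$ be a countable abelian group. For $A,B\subseteq G$ and $g\in G$, $A+B=\{a+b:a\in A,b\in B\}$, $A-B=\{a-b:a\in A,b\in B\}$, $A+g=\{a+g:a\in A\}$. A Følner sequence for $G$ is a sequence $\mathbf{\Phi}=(\Phi_n)_{n\in\mathbb{N}}$ of finite (nonempty) subsets of $G$ such that $\lim_{n\to\infty}\frac{|(\Phi_n+g)\cap\Phi_n|}{|\Phi_n|}=1$ for every $g\in G$. For $A\subseteq G$, $\bar d_{\mathbf{\Phi}}(A):=\limsup_{n\to\infty}\frac{|A\cap\Phi_n|}{|\Phi_n|}$, and the upper Banach density of $A$ is $d^*(A):=\sup\{\bar d_{\mathbf{\Phi}}(A):\mathbf{\Phi}\text{ is a Følner sequence for }G\}$. A set $S\subseteq G$ is syndetic if there is a finite set $F\subseteq G$ with $S+F=G$. A set $B\subseteq G$ is piecewise syndetic if there is a syndetic set $S\subseteq G$ such that for every finite $F\subseteq S$ there exists $g\in G$ with $F+g\subseteq B$. *)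

(* Defs.v *)
From mathcomp Require Import all_boot all_order all_algebra finmap.
From mathcomp Require Import all_classical all_reals all_analysis.
(* The notations of monalg clash with those of MathComp-Analysis. *)
From mathcomp Require Import -(notations) monalg.

Set Implicit Arguments.
Unset Strict Implicit.
Unset Printing Implicit Defensive.

Import Order.TTheory GRing.Theory Num.Theory.
Import numFieldNormedType.Exports.

Local Open Scope classical_set_scope.
Local Open Scope ring_scope.

Section AbelianGroup.
Variable G : zmodType.
Implicit Types (A B S : set G) (g : G) (F : {fset G}) (Phi : nat -> {fset G}).

Definition sumset A B : set G := [set a + b | a in A & b in B].

Definition diffset A B : set G := [set a - b | a in A & b in B].

Definition translate A g : set G := [set a + g | a in A].

Definition ftranslate F g : {fset G} := [fset (a + g)%R | a in F]%fset.

Definition folner (R : realType) Phi : Prop :=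
  (forall n, Phi n != fset0) /\
  forall g, (fun n => #|` (ftranslate (Phi n) g `&` Phi n)%fset|%:R
                      / #|` Phi n|%:R : R) @ \oo --> (1 : R).

Definition upper_density (R : realType) Phi A : \bar R :=
  limn_esup (fun n => (#|` [fset x in Phi n | x \in A]%fset|%:R
                       / #|` Phi n|%:R)%:E).

Definition upper_Banach_density (R : realType) A : \bar R :=
  ereal_sup [set upper_density R Phi A | Phi in folner R].

Definition syndetic S : Prop :=
  exists F, sumset S [set` F] = setT.

Definition piecewise_syndetic B : Prop :=
  exists S, syndetic S /\
    forall F, [set` F] `<=` S -> exists g, translate [set` F] g `<=` B.

End AbelianGroup.

(* [malg K V] is the type of finitely supported functions K -> V, with
   pointwise addition: the direct sum of copies of V indexed by K. *)
Definition G2 : zmodType := malg nat 'Z_2.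

(* Main.v *)
(** The set [A] must avoid a set [E] all of whose translates are chromatic
    recurrence sets.  [E] consists of [e_0] and of the elements [g + e], where,
    for every [k] and [g], [e] runs over the vectors of weight at least [d - k]
    supported on a fresh block of [d] coordinates.  By Kneser's theorem (through
    Ky Fan's lemma) every [k]-colouring has a monochromatic pair differing by
    such an [e]; hence [B - B + g] meets [E] whenever [B] is piecewise syndetic.

    Adding [e] exchanges the two majority values on the block, up to ties within
    [k], which are rare since [d] is large.  Keeping a set [A] that avoids [e_0]
    where the majority is [0], replacing it by its translate by [g + e_0] where
    the majority is [1], and discarding near-ties therefore gives a set of almost
    the same density that avoids [g + e] and everything avoided before.  Starting
    from the index 2 subgroup [x_0 = 0], the density stays close to [1/2]. *)

Require Import Defs.
From mathcomp Require Import all_boot all_order all_algebra finmap.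
From mathcomp Require Import all_classical all_reals all_analysis.
From mathcomp Require Import zify lra.
From mathcomp Require Import -(notations) monalg.

Set Implicit Arguments.
Unset Strict Implicit.
Unset Printing Implicit Defensive.

Import Order.TTheory GRing.Theory Num.Theory.
Import numFieldNormedType.Exports.

(** * Ky Fan's lemma modulo 2 and Kneser's theorem *)

Section Coboundary.
Variable T : Type.
Implicit Types (f g : seq T -> bool) (s : seq T).

(** The coboundary of simplicial cochains modulo 2; the recursion runs over the deletions of one
    vertex from [s]. *)
Fixpoint coboundary f s : bool :=
  if s is x :: s' then f s' (+) coboundary (fun t => f (x :: t)) s' else false.

Lemma coboundaryD f g s :
  coboundary (fun t => f t (+) g t) s = coboundary f s (+) coboundary g s.
Proof. by elim: s f g => //= x s IH f g; rewrite IH addbACA. Qed.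

Lemma coboundary0 s : coboundary (fun=> false) s = false.
Proof. by elim: s => //= x s ->. Qed.

Lemma eq_coboundary f g s : f =1 g -> coboundary f s = coboundary g s.
Proof.
by elim: s f g => //= x s IH f g fg; rewrite fg; congr addb; apply: IH => t.
Qed.

Lemma coboundaryK f s : coboundary (coboundary f) s = false.
Proof. by elim: s f => //= x s IH f; rewrite coboundaryD IH addbF addbb. Qed.

End Coboundary.

Lemma coboundary_map (T U : Type) (h : T -> U) f s :
  coboundary (fun t => f (map h t)) s = coboundary f (map h s).
Proof. by elim: s f => //= x s IH f; rewrite (IH (fun t => f (h x :: t))). Qed.

Lemma eq_coboundary_in (T : eqType) (f g : seq T -> bool) s :
    (forall t, subseq t s -> size s = (size t).+1 -> f t = g t) ->
  coboundary f s = coboundary g s.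
Proof.
elim: s f g => // x s IH f g fg; rewrite /= (fg s (subseq_cons s x) erefl).
by congr addb; apply: IH => t ts st; apply: fg; rewrite /= ?eqxx ?st.
Qed.

(** [rem x] deletes the first occurrence of [x] instead of the given one, which only permutes the
    result. In this form the order of [s] no longer matters. *)
Lemma coboundary_rem (T : eqType) (f : seq T -> bool) s :
    (forall t u, perm_eq t u -> f t = f u) ->
  coboundary f s = \big[addb/false]_(x <- s) f (rem x s).
Proof.
elim: s f => [|x s IH] f fP /=; first by rewrite big_nil.
rewrite big_cons eqxx; congr addb.
rewrite IH => [|t u tu]; last by apply: fP; rewrite perm_cons.
rewrite !big_seq; apply: eq_bigr => y ys.
by case: eqP => // ->; apply: fP; rewrite perm_sym perm_to_rem.
Qed.

Lemma coboundary_perm (T : eqType) (f : seq T -> bool) s t :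
    (forall t u, perm_eq t u -> f t = f u) ->
  perm_eq s t -> coboundary f s = coboundary f t.
Proof.
move=> fP st; rewrite !coboundary_rem // (perm_big _ st) /=.
rewrite !big_seq; apply: eq_bigr => x xt; apply: fP.
rewrite -(perm_cons x) -(permPl (perm_to_rem _)) ?(perm_mem st) //.
by rewrite -(permPr (perm_to_rem xt)).
Qed.

(** * Alternating sequences of signed labels *)

Fixpoint alternating (b : bool) (s : seq bool) : bool :=
  if s is x :: s' then (x == b) && alternating (~~ b) s' else true.

(** If a nonempty [s] alternates from [b], only the deletion of its last entry counts; if from
    [~~ b], only that of its first. Otherwise none counts, or exactly the two entries of a single
    repetition do. *)
Lemma coboundary_alternating b s :
  coboundary (alternating b) s = alternating b s (+) alternating (~~ b) s.
Proof.
elim: s b => //= x s IH b; case: eqP => [->|/eqP xb] /=.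
  by rewrite IH negbK addbA addbC; case: b; case: (alternating _ _); case: (alternating _ _).
rewrite coboundary0; have -> : x == ~~ b by case: x b xb => [] [].
by rewrite negbK addbF.
Qed.

Lemma alternating_negb b s : alternating b (map negb s) = alternating (~~ b) s.
Proof. by elim: s b => //= x s IH b; rewrite IH; case: x; case: b. Qed.

Lemma alternating_ltn b s :
  sorted leq s -> alternating b (map odd s) -> sorted ltn s.
Proof.
elim: s b => // x [|y s] IH b //= /andP[xy ys] /andP[/eqP xb /andP[/eqP yb alt]].
have /= -> := IH (~~ b) ys; last by rewrite yb eqxx.
rewrite ltn_neqAle xy !andbT; apply/eqP => exy.
by move: yb; rewrite -exy xb; case: (b).
Qed.

(** A label is a natural number [l], standing for the signed label with
    absolute value [l./2] and sign [odd l]. *)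
Definition altlab b (L : seq nat) := alternating b (map odd (sort leq L)).

Lemma altlab_perm b L M : perm_eq L M -> altlab b L = altlab b M.
Proof.
rewrite /altlab => /(perm_sortP leq_total leq_trans anti_leq).
by move=> ->.
Qed.

Lemma coboundary_altlab b L :
  coboundary (altlab b) L = altlab b L (+) altlab (~~ b) L.
Proof.
rewrite (@coboundary_perm _ _ L (sort leq L)); first last.
- by rewrite perm_sym perm_sort.
- exact: altlab_perm.
rewrite /altlab -coboundary_alternating -coboundary_map.
apply: eq_coboundary_in => t ts _; rewrite sorted_sort //; first exact: leq_trans.
exact: subseq_sorted leq_trans _ _ ts (sort_sorted leq_total L).
Qed.

Definition opplab l := (~~ odd l) + l./2.*2.

(** Fan's condition that no two labels are opposite; repetitions are allowed. *)
Definition consistent (L : seq nat) :=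
  {in L &, forall l m, l./2 = m./2 -> l = m}.

Lemma opplab_bit (b : bool) a : opplab (b + a.*2) = ~~ b + a.*2.
Proof. by rewrite /opplab half_bit_double oddD odd_double oddb addbF. Qed.

(** Negation moves a label only within its pair [2a], [2a + 1], so it could change the order of
    opposite labels only. *)
Lemma sort_opplab L :
  consistent L -> sort leq (map opplab L) = map opplab (sort leq L).
Proof.
move=> cL; apply: (sorted_eq leq_trans anti_leq).
- exact: sort_sorted leq_total _.
- rewrite sorted_map.
  apply: (@sub_in_sorted _ (mem L) leq); last exact: sort_sorted leq_total _.
    move=> l m lL mL lm /=; rewrite /opplab.
    by have := cL l m lL mL; lia.
  by apply/allP => x; rewrite mem_sort.
- rewrite perm_sort; apply: perm_map.
  by rewrite perm_sym perm_sort.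
Qed.

Lemma altlab_opplab b L :
  consistent L -> altlab b (map opplab L) = altlab (~~ b) L.
Proof.
move=> cL; rewrite /altlab sort_opplab // -alternating_negb -!map_comp.
congr alternating; apply: eq_map => l /=.
by rewrite /opplab oddD odd_double addbF oddb.
Qed.

(** Alternation makes the sorted labels strictly increasing; consistency then makes their absolute
    values distinct. *)
Lemma altlab_size b L n :
  consistent L -> altlab b L -> {in L, forall l, l./2 < n} -> size L <= n.
Proof.
move=> cL aL bL.
have uL : uniq L.
  rewrite -(sort_uniq leq); apply: (sorted_uniq ltn_trans ltnn).
  exact: alternating_ltn (sort_sorted leq_total _) aL.
have uh : uniq (map half L) by rewrite map_inj_in_uniq.
rewrite -(size_map half) -(size_iota 0 n); apply: uniq_leq_size => // x.
by case/mapP => l lL ->; rewrite mem_iota /= add0n bL.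
Qed.

(** * Sums over barycentric subdivisions *)

Section FlagSum.
Variable T : eqType.
Implicit Types (f g : seq (seq T) -> bool) (w : seq T) (F : seq (seq T)).

(** Faces are lists of vertices.  [flagSum r f w] is the mod 2 sum of [f] over
    the barycentric subdivision of the face [w] of [r] vertices. *)
Fixpoint flagSum r f w : bool :=
  if r is r'.+1 then coboundary (flagSum r' (fun F => f (w :: F))) w else f [::].

Lemma flagSumD r f g w :
  flagSum r (fun F => f F (+) g F) w = flagSum r f w (+) flagSum r g w.
Proof.
elim: r f g w => //= r IH f g w; rewrite -coboundaryD.
by apply: eq_coboundary => v; rewrite -IH.
Qed.

(** A simplex of the barycentric subdivision of [w]: a chain of nonempty faces, listed from the
    largest down. *)
Definition flag w F :=
  all (fun v => (v != [::]) && subseq v w) F && pairwise (fun u v => subseq v u) F.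

Lemma flag_subseq v w F : subseq v w -> flag v F -> flag w F.
Proof.
move=> vw /andP[Fv pF]; rewrite /flag pF andbT; apply: sub_all Fv => u.
by case/andP => -> uv; rewrite (subseq_trans uv vw).
Qed.

Lemma eq_flagSum r f g w : size w = r ->
  (forall F, size F = r -> flag w F -> f F = g F) ->
  flagSum r f w = flagSum r g w.
Proof.
elim: r f g w => [|r IH] f g w sw fg /=; first exact: fg.
apply: eq_coboundary_in => v vw; rewrite sw => -[sv].
apply: IH => // F sF /andP[Fv pF]; apply: fg; rewrite /= ?sF //.
have wF : all (fun u => (u != [::]) && subseq u w) F.
  apply: sub_all Fv => u /andP[-> /=] uv; exact: subseq_trans uv vw.
rewrite /flag /= wF subseq_refl pF !andbT -size_eq0 sw /=.
by apply: sub_all wF => u /andP[].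
Qed.

(** Subdivision commutes with the boundary. Removing the top face [w] of a flag leaves a flag of a
    facet of [w]; by induction the other removals sum to a double coboundary, which vanishes. *)
Lemma flagSum_coboundary r f w : size w = r.+1 ->
  flagSum r.+1 (coboundary f) w = coboundary (flagSum r f) w.
Proof.
elim: r f w => [|r IH] f w sw.
  by case: w sw => [|x []] //= _; rewrite addbF.
have -> : flagSum r.+2 (coboundary f) w =
  coboundary (fun v => flagSum r.+1 (fun F => f F (+)
     coboundary (fun F => f (w :: F)) F) v) w by [].
rewrite (eq_coboundary _ (fun v => flagSumD _ _ _ v)) coboundaryD.
rewrite [X in _ (+) X](_ : _ = false) ?addbF //.
rewrite -[RHS](coboundaryK (flagSum r (fun F => f (w :: F))) w).
by apply: eq_coboundary_in => v _; rewrite sw => -[/esym /IH].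
Qed.

End FlagSum.

Lemma flagSum_map (T U : eqType) (h : T -> U) r f w :
  flagSum r (fun F => f (map (map h) F)) w = flagSum r f (map h w).
Proof.
elim: r f w => //= r IH f w; rewrite -coboundary_map; apply: eq_coboundary => v.
by rewrite -IH.
Qed.

(** * Sums over the facets of the cross-polytope *)

Section SignSum.
Implicit Types (f g : seq (nat * bool) -> bool) (w : seq (nat * bool)).

(** The vertex [e_j] or [- e_j] of the cross-polytope is encoded as [(j, true)]
    or [(j, false)]; [signSum i f] sums [f] over the [2 ^ i] facets. *)
Fixpoint signSum i f : bool :=
  if i is j.+1 then
    signSum j (fun w => f ((j, true) :: w)) (+)
    signSum j (fun w => f ((j, false) :: w))
  else f [::].

Definition facet i w := map fst w == rev (iota 0 i).

Lemma eq_signSum i f g :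
  (forall w, facet i w -> f w = g w) -> signSum i f = signSum i g.
Proof.
elim: i f g => [|i IH] f g fg /=; first exact: fg.
have facetS b w : facet i w -> facet i.+1 ((i, b) :: w).
  rewrite /facet -addn1 iotaD rev_cat /= => /eqP ->.
  by rewrite add0n.
by congr addb; apply: IH => w /facetS /fg.
Qed.

Lemma signSumD i f g :
  signSum i (fun w => f w (+) g w) = signSum i f (+) signSum i g.
Proof. by elim: i f g => //= i IH f g; rewrite !IH addbACA. Qed.

Lemma signSum0 i : signSum i (fun=> false) = false.
Proof. by elim: i => //= i ->. Qed.

(** The sphere has no boundary: deleting a vertex gives the same face from the two facets that
    differ in its sign. *)
Lemma signSum_coboundary i f : signSum i (coboundary f) = false.
Proof.
elim: i f => //= i IH f.
by rewrite !signSumD !IH !addbF addbb.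
Qed.

Definition opp_face w := [seq (x.1, ~~ x.2) | x <- w].

Lemma signSum_opp i f : signSum i (fun w => f (opp_face w)) = signSum i f.
Proof.
elim: i f => //= i IH f.
by rewrite (IH (fun w => f ((i, false) :: w))) (IH (fun w => f ((i, true) :: w))) addbC.
Qed.

End SignSum.

(* Ky Fan's lemma for the barycentric subdivision of the cross-polytope. *)
Lemma octahedral_Fan (lab : seq (nat * bool) -> nat) (d : nat) :
    (forall w v, facet d w -> subseq v w -> v != [::] ->
       lab (opp_face v) = opplab (lab v)) ->
    (forall w F, facet d w -> flag w F -> consistent (map lab F)) ->
  exists2 w, facet d w &
    exists F, [/\ size F = d, flag w F & altlab true (map lab F)].
Proof.
move=> labN labC.
pose p b F := altlab b (map lab F).
have facet_size i w : facet i w -> size w = i.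
  by move/eqP/(congr1 size); rewrite size_map size_rev size_iota.
(* The hypotheses on [lab] concern faces of full facets only, so lower-dimensional facets have to be
   extended. *)
have extend i w : facet i w -> i <= d -> exists2 w', facet d w' & subseq w w'.
  move=> fw id; exists ([seq (j, true) | j <- rev (iota i (d - i))] ++ w).
    rewrite /facet map_cat -map_comp map_id_in // (eqP fw) -rev_cat.
    by rewrite -iotaD subnKC.
  exact: suffix_subseq.
(* The half sphere of facets containing [e_i] has the full sphere one dimension
   lower as boundary; with [coboundary_altlab] this makes [Tot] constant. *)
pose Tot i := signSum i (flagSum i (p true)).
have TotS i : i < d -> Tot i.+1 = Tot i.
  move=> id; rewrite {1}/Tot [LHS]/=.
  (* The facets containing [- e_i] are the antipodes of those containing [e_i]. *)
  rewrite -[X in _ (+) X]signSum_opp -signSumD.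
  transitivity (signSum i (fun w => coboundary (flagSum i (p true)) ((i, true) :: w))).
    apply: eq_signSum => w fw.
    have fw' : facet i.+1 ((i, true) :: w).
      rewrite /facet -addn1 iotaD rev_cat /= (eqP fw).
      by rewrite add0n.
    have [w' fw'd ww'] := extend _ _ fw' id.
    have sw := facet_size _ _ fw'.
    rewrite -flagSum_coboundary //.
    rewrite -[RHS]/(flagSum i.+1 (coboundary (p true)) ((i, true) :: w)).
    rewrite -[X in X (+) _]/(flagSum i.+1 (p true) ((i, true) :: w)).
    rewrite -[X in _ (+) X]/(flagSum i.+1 (p true) (opp_face ((i, true) :: w))).
    rewrite -flagSum_map -flagSumD.
    apply: eq_flagSum => // F sF /(flag_subseq ww') flF.
    rewrite /p coboundary_map coboundary_altlab; congr addb.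
    rewrite -altlab_opplab; last exact: labC flF.
    congr altlab; rewrite -!map_comp; apply/eq_in_map => v vF /=.
    case/andP: flF => /allP /(_ v vF) /andP[v0 vw'] _.
    exact: labN vw' v0.
  (* Deleting [(i, true)] gives [Tot i]; the remaining deletions form a coboundary on the closed
     sphere. *)
  by rewrite signSumD signSum_coboundary addbF.
(* [Tot 0] is the value at the empty flag, which alternates vacuously. *)
have Tot1 i : i <= d -> Tot i.
  by elim: i => // i IH id; rewrite TotS // IH // ltnW.
have [//|nex] := pselect (exists2 w, facet d w &
    exists F, [/\ size F = d, flag w F & altlab true (map lab F)]).
have := Tot1 d (leqnn d).
rewrite /Tot (@eq_signSum d _ (fun=> false)) ?signSum0 // => w fw.
rewrite (@eq_flagSum _ d _ (fun=> false) w (facet_size d w fw)).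
  case: (d) w {fw} => //= e w.
  have -> : coboundary (flagSum e (fun=> false)) w = coboundary (fun=> false) w.
    by apply: eq_coboundary; elim: e => //= e IH v; rewrite (eq_coboundary _ IH) coboundary0.
  exact: coboundary0.
move=> F sF fF; apply/negP => aF; apply: nex; exists w => //; by exists F.
Qed.

(** * Kneser's theorem from Fan's lemma *)

Lemma flag_comparable (T : eqType) (w : seq T) F :
  flag w F -> {in F &, forall u v, subseq u v || subseq v u}.
Proof.
case/andP => _; elim: F => //= x F IH /andP[/allP xF pF] u v.
rewrite !inE => /predU1P[->|uF] /predU1P[->|vF]; rewrite ?subseq_refl //.
- by rewrite xF ?orbT.
- by rewrite xF.
- exact: IH.
Qed.

Definition pos_part (w : seq (nat * bool)) := [seq x.1 | x <- w & x.2].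
Definition neg_part (w : seq (nat * bool)) := [seq x.1 | x <- w & ~~ x.2].

Lemma pos_part_opp w : pos_part (opp_face w) = neg_part w.
Proof. by rewrite /pos_part /opp_face filter_map -map_comp. Qed.

Lemma neg_part_opp w : neg_part (opp_face w) = pos_part w.
Proof.
rewrite /neg_part /opp_face filter_map -map_comp.
by congr map; apply: eq_filter => x /=; rewrite negbK.
Qed.

Lemma size_pos_part v w : subseq v w -> size (pos_part v) <= size (pos_part w).
Proof.
move=> vw; rewrite !size_map; apply: size_subseq.
by rewrite subseq_filter filter_all (subseq_trans (filter_subseq _ _) vw).
Qed.

Lemma size_neg_part v w : subseq v w -> size (neg_part v) <= size (neg_part w).
Proof.
move=> vw; rewrite !size_map; apply: size_subseq.
by rewrite subseq_filter filter_all (subseq_trans (filter_subseq _ _) vw).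
Qed.

Lemma size_pos_neg w : size (pos_part w) + size (neg_part w) = size w.
Proof. by rewrite !size_map !size_filter count_predC. Qed.

Lemma pos_neg_disjoint w x y : uniq (map fst w) -> subseq x w -> subseq y w ->
  ~~ has (mem (pos_part x)) (neg_part y).
Proof.
move=> uw xw yw; apply/hasPn => a /mapP[[b []]]; rewrite mem_filter //= => byy ->{a}.
apply/mapP => -[[b' []]]; rewrite mem_filter //= => bx eb.
have := mem_subseq yw byy; have := mem_subseq xw bx.
elim: w uw {xw yw byy bx} => //= z w IH /andP[zw uw].
rewrite !inE => /predU1P[ez|bw] /predU1P[ez'|bw']; last exact: IH.
- by rewrite -ez in ez'.
- by case/negP: zw; apply/mapP; exists (b, false) => //=; rewrite -ez.
- by case/negP: zw; apply/mapP; exists (b', true) => //=; rewrite -ez'.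
Qed.

(* Faces with fewer than [d - k] vertices are labelled by their dimension, the
   others by the smaller of the colours of their positive and negative parts;
   fewer than [d] labels remain. *)
Lemma generalized_Kneser (d k : nat) (c : seq nat -> nat) :
    (forall u, c u < k) ->
  exists u v, [/\ subseq u (rev (iota 0 d)), subseq v (rev (iota 0 d)),
    ~~ has (mem u) v, d <= size u + size v + k & c u = c v].
Proof.
move=> ck; case: (leqP d k) => [dk|kd].
  by exists [::], [::]; rewrite !sub0seq add0n.
pose good (u v : seq nat) := [/\ subseq u (rev (iota 0 d)), subseq v (rev (iota 0 d)),
    ~~ has (mem u) v, d <= size u + size v + k & c u = c v].
have [[u [v uv]]|ngood] := pselect (exists u v, good u v).
  by exists u, v.
(* Otherwise [pos_part x] and [neg_part y] form the wanted pair: together they are at least as large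
   as the smaller of [x] and [y]. *)
have nposneg (w x y : seq (nat * bool)) : facet d w -> subseq x w -> subseq y w ->
    subseq x y || subseq y x -> d <= size x + k -> d <= size y + k ->
    c (pos_part x) <> c (neg_part y).
  move=> fw xw yw xy dx dy cxy; apply: ngood; exists (pos_part x), (neg_part y).
  have part_sub p z : subseq z w -> subseq (map fst [seq x <- z | p x]) (rev (iota 0 d)).
    move=> zw; rewrite -(eqP fw); apply: map_subseq.
    exact: subseq_trans (filter_subseq _ _) zw.
  split=> //; try exact: part_sub.
    apply: pos_neg_disjoint xw yw.
    by rewrite (eqP fw) rev_uniq iota_uniq.
  case/orP: xy => [xy|yx].
    have := size_neg_part xy; have := size_pos_neg x; lia.
  have := size_pos_part yx; have := size_pos_neg y; lia.
(* The sign of a small face is that of its first vertex; the sign of a large one tells which part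
   has the smaller colour. The offset [d - k] keeps the two ranges of absolute values apart. *)
pose lab w := if size w + k < d then (head (0, true) w).2 + (size w).*2 else
  (c (pos_part w) < c (neg_part w)) +
  (d - k + minn (c (pos_part w)) (c (neg_part w))).*2.
have labN (w v : seq (nat * bool)) : facet d w -> subseq v w -> v != [::] ->
    lab (opp_face v) = opplab (lab v).
  move=> fw vw v0; rewrite /lab size_map pos_part_opp neg_part_opp.
  case: ltnP => dv.
    by rewrite opplab_bit; case: (v) v0.
  rewrite opplab_bit minnC; congr (nat_of_bool _ + _).
  have := nposneg w v v fw vw vw; rewrite subseq_refl => /(_ isT dv dv).
  lia.
have labC (w : seq (nat * bool)) (F : seq (seq (nat * bool))) :
    facet d w -> flag w F -> consistent (map lab F).
  move=> fw flF.
  suff labF (x y : seq (nat * bool)) : x \in F -> y \in F ->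
      (lab x)./2 = (lab y)./2 -> lab x = lab y.
    by move=> _ _ /mapP[x xF ->] /mapP[y yF ->]; apply: labF.
  move=> xF yF; have xy := flag_comparable flF xF yF.
  have sub z : z \in F -> subseq z w.
    by case/andP: flF => /allP zF _ /zF /andP[].
  rewrite /lab; case: (ltnP (size x + k)) => dx; case: (ltnP (size y + k)) => dy;
    rewrite !half_bit_double => e.
  - suff -> : x = y by [].
    case/orP: xy => xy; last apply/esym; apply/eqP.
      by rewrite -(geq_leqif (size_subseq_leqif xy)) e.
    by rewrite -(geq_leqif (size_subseq_leqif xy)) e.
  - lia.
  - lia.
  (* Opposite labels would give the positive part of one face the colour of the negative part of the
     other. *)
  - have nxy := nposneg w x y fw (sub x xF) (sub y yF) xy dx dy.
    rewrite orbC in xy.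
    have nyx := nposneg w y x fw (sub y yF) (sub x xF) xy dy dx.
    lia.
have [w fw [F [sF flF aF]]] := octahedral_Fan labN labC.
exfalso; suff : size (map lab F) <= d.-1 by rewrite size_map sF; lia.
apply: altlab_size aF _; first exact: labC flF.
suff labF (x : seq (nat * bool)) : x \in F -> (lab x)./2 < d.-1.
  by move=> _ /mapP[x xF ->]; apply: labF.
move=> xF; have xw : subseq x w by case/andP: flF => /allP zF _; case/andP: (zF x xF).
rewrite /lab; case: (ltnP (size x + k)) => dx; rewrite half_bit_double.
  by have := ck [::]; lia.
(* The two colours differ, so the smaller is at most [k - 2]; this saves the one label needed for a
   contradiction. *)
have := nposneg w x x fw xw xw; rewrite subseq_refl => /(_ isT dx dx).
have := ck (pos_part x); have := ck (neg_part x); lia.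
Qed.

(** * Vectors of nearly balanced weight are rare *)

Lemma leq_bin_center n m : 'C(n.*2, m) <= 'C(n.*2, n).
Proof.
have below i : i <= n -> 'C(n.*2, i) <= 'C(n.*2, n).
  move=> lin; rewrite -(subKn lin); move: (n - i) => {i lin} j.
  elim: j => [|j IH]; first by rewrite subn0.
  apply: leq_trans IH; case: (leqP n j) => nj.
    by have [-> ->] : n - j.+1 = 0 /\ n - j = 0 by lia.
  have := mul_bin_left n.*2 (n - j.+1); rewrite -subSn // subSS => e.
  rewrite -(leq_pmul2l (_ : 0 < n - j)) ?subn_gt0 // e leq_mul2r.
  apply/orP; right; lia.
case: (leqP m n) => [|nm]; first exact: below.
case: (leqP m n.*2) => [mn|/bin_small -> //].
rewrite -bin_sub //; apply: below; lia.
Qed.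

(** The bound [4 ^ n / sqrt (2n + 1)] on the central coefficient, squared; the induction rests on
    [(2n + 1) (2n + 3) <= (2n + 2) ^ 2]. *)
Lemma bin_center_sqr n : 'C(n.*2, n) ^ 2 * n.*2.+1 <= (2 ^ n.*2) ^ 2.
Proof.
elim: n => [|n IH]; first by rewrite bin0.
have rec : n.+1 * 'C(n.+1.*2, n.+1) = 2 * n.*2.+1 * 'C(n.*2, n).
  have := mul_bin_diag n.+1.*2 n; have := mul_bin_down n.*2.+1 n.
  rewrite doubleS /=; have -> : n.*2.+1 - n = n.+1 by lia.
  nia.
rewrite -(leq_pmul2l (_ : 0 < n.+1 ^ 2)) // mulnA -expnMn rec doubleS.
rewrite !expnS !expn0 in IH *.
move: IH; move: ('C(_, _)) (2 ^ _) => c p IH.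
suff : (4 * n.*2.+1 * n.*2.+3) * (c * (c * 1) * n.*2.+1) <= 16 * (n.+1 * n.+1) * (p * (p * 1)).
  by lia.
apply: leq_mul => //; nia.
Qed.

Local Open Scope classical_set_scope.
Local Open Scope ring_scope.

(** At most [2k + 1] terms occur, each at most [2 ^ d / sqrt (d + 1)]; [d] is chosen with
    [(2k + 1) / sqrt (d + 1) <= delta]. *)
Lemma middle_binomials (R : realType) (k : nat) (delta : R) : 0 < delta ->
  exists2 d, (k < d)%N &
    (\sum_(w < d.+1 | (d <= w.*2 + k)%N && (w.*2 <= d + k)%N) 'C(d, w))%:R
      <= delta * 2 ^+ d.
Proof.
move=> delta0.
have [n0 n0P] : exists n : nat, ((k.*2.+1)%:R / delta) ^+ 2 <= n%:R.
  by exists (Num.truncn (((k.*2.+1)%:R / delta) ^+ 2)).+1; rewrite ltW // truncnS_gt.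
pose n := (n0 + k.+1)%N.
have nP : ((k.*2.+1)%:R / delta) ^+ 2 <= (n.*2.+1)%:R :> R.
  by apply: le_trans n0P _; rewrite ler_nat /n; lia.
exists n.*2; first by rewrite /n; lia.
have mid : (\sum_(w < n.*2.+1 | (n.*2 <= w.*2 + k)%N && (w.*2 <= n.*2 + k)%N)
   'C(n.*2, w) <= k.*2.+1 * 'C(n.*2, n))%N.
  apply: (@leq_trans (\sum_(w < n.*2.+1 | (n.*2 <= w.*2 + k)%N && (w.*2 <= n.*2 + k)%N)
   'C(n.*2, n))%N).
    by apply: leq_sum => w _; apply: leq_bin_center.
  rewrite sum_nat_const leq_mul2r; apply/orP; right.
  rewrite -[k.*2.+1](size_iota (n - k)) cardE -(size_map val).
  apply: uniq_leq_size; first by rewrite map_inj_uniq ?enum_uniq //; apply: val_inj.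
  move=> _ /mapP[w + ->]; rewrite mem_enum mem_iota unfold_in /=; lia.
apply: (@le_trans _ _ ((k.*2.+1 * 'C(n.*2, n))%:R)); first by rewrite ler_nat.
rewrite natrM -ler_pdivrMl // mulrA mulrC [_^-1 * _]mulrC.
rewrite -(@ler_pXn2r _ 2) ?nnegrE ?exprn_ge0
   ?mulr_ge0 ?divr_ge0 ?ler0n ?invr_ge0 ?(ltW delta0) //.
rewrite exprMn; apply: (@le_trans _ _ (('C(n.*2, n) ^ 2 * n.*2.+1)%:R)).
  by rewrite natrM natrX; apply: ler_wpM2l; rewrite ?exprn_ge0.
by rewrite -natrX -natrX ler_nat bin_center_sqr.
Qed.

(** * Coordinates, cubes and majority values in [G2] *)

Definition basis (i : nat) : G2 := mkmalgU i 1.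
Definition bit (i : nat) (x : G2) : bool := mcoeff i x != 0.

Lemma Z2_addb (a b : 'Z_2) : (a + b != 0) = (a != 0) (+) (b != 0).
Proof. by case: a b => [[|[|?]] ?] [[|[|?]] ?]. Qed.

Lemma bitD i x y : bit i (x + y) = bit i x (+) bit i y.
Proof. by rewrite /bit (mcoeffD i) Z2_addb. Qed.

Lemma bit0 i : bit i 0 = false.
Proof. by rewrite /bit mcoeff0 eqxx. Qed.

Lemma bit_basis i j : bit i (basis j) = (i == j).
Proof. by rewrite /bit mcoeffU [j == i]eq_sym; case: (i == j). Qed.

Lemma bit_inj x y : (forall i, bit i x = bit i y) -> x = y.
Proof.
move=> xy; apply/malgP => i; have := xy i; rewrite /bit.
by case: (mcoeff i x) (mcoeff i y) => [[|[|?]] ?] [[|[|?]] ?] // _; apply/val_inj.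
Qed.

Lemma addG2xx (x : G2) : x + x = 0.
Proof. by apply: bit_inj => i; rewrite bitD bit0 addbb. Qed.

Lemma addG2K (x y : G2) : x + y + y = x.
Proof. by rewrite -addrA addG2xx addr0. Qed.

Lemma subG2 (x y : G2) : x - y = x + y.
Proof. by congr (_ + _); apply/eqP; rewrite eq_sym -addr_eq0 addG2xx. Qed.

Definition indicator (s : seq nat) : G2 := \sum_(i <- s) basis i.

Lemma bit_indicator i s : uniq s -> bit i (indicator s) = (i \in s).
Proof.
rewrite /indicator; elim: s => [|j s IH] /=; first by rewrite big_nil bit0.
case/andP => js us; rewrite big_cons bitD bit_basis inE IH //.
by case: eqP => // ->; rewrite (negPf js).
Qed.

Lemma indicatorP x : exists2 s, uniq s & x = indicator s.
Proof.
exists (msupp x); first exact: fset_uniq.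
apply: bit_inj => i; rewrite bit_indicator ?fset_uniq //.
by rewrite /bit mcoeff_neq0.
Qed.

Definition supported_below t x := forall i, (t <= i)%N -> bit i x = false.

Lemma supported_belowD t x y :
  supported_below t x -> supported_below t y -> supported_below t (x + y).
Proof. by move=> xt yt i ti; rewrite bitD xt ?yt. Qed.

Lemma supported_belowW t s x :
  (s <= t)%N -> supported_below s x -> supported_below t x.
Proof. by move=> st xs i ti; rewrite xs ?(leq_trans st). Qed.

(* The subgroup spanned by the basis vectors [t, ..., t + d - 1]. *)
Fixpoint cube (t d : nat) : seq G2 :=
  if d is d'.+1 then
    cube t d' ++ [seq x + basis (t + d') | x <- cube t d']
  else [:: 0].

Lemma mem_cube t d x :
  x \in cube t d <-> (forall i, bit i x -> (t <= i < t + d)%N).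
Proof.
elim: d x => [|d IH] x /=.
  rewrite inE; split => [/eqP -> i|x0]; first by rewrite bit0.
  apply/eqP/bit_inj => i; rewrite bit0; apply/negbTE/negP => /x0; lia.
rewrite mem_cat; split.
  case/orP => [/IH xd i /xd|/mapP[y /IH yd ->] i]; first lia.
  rewrite bitD bit_basis; case: eqP => [-> _|_]; first lia.
  by rewrite addbF => /yd; lia.
move=> xd; case: (boolP (bit (t + d) x)) => xtd; apply/orP; [right|left].
  apply/mapP; exists (x + basis (t + d)); last by rewrite addG2K.
  apply/IH => i; rewrite bitD bit_basis.
  case: eqP => [->|/eqP ne]; first by rewrite xtd.
  by rewrite addbF => /xd; lia.
apply/IH => i xi; have := xd i xi; case: (i =P t + d)%N => [e|]; last lia.
by rewrite -e xi in xtd.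
Qed.

Lemma mem_cube0 t x : x \in cube 0 t <-> supported_below t x.
Proof.
split=> [/mem_cube xt i ti|xt].
  by apply/negbTE/negP => /xt; lia.
by apply/mem_cube => i; apply: contraTT => ti; rewrite xt //; lia.
Qed.

Lemma size_cube t d : size (cube t d) = (2 ^ d)%N.
Proof. by elim: d => //= d IH; rewrite size_cat size_map IH expnS; lia. Qed.

Lemma cube_uniq t d : uniq (cube t d).
Proof.
elim: d => //= d IH; rewrite cat_uniq IH map_inj_uniq ?IH ?andbT; last exact: addIr.
apply/hasPn => x /mapP[y /mem_cube yd ->]; apply/negP => /mem_cube /(_ (t + d)%N).
rewrite bitD bit_basis eqxx addbT.
by case: (boolP (bit _ y)) => [/yd|_ /(_ isT)]; lia.
Qed.

Lemma count_cube_translate t (A : pred G2) u : supported_below t u ->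
  count (fun x => A (x + u)) (cube 0 t) = count A (cube 0 t).
Proof.
move=> ut; rewrite -(count_map (fun x => x + u)); apply/permP.
apply: uniq_perm; rewrite ?map_inj_uniq ?cube_uniq //; first exact: addIr.
move=> x; apply/mapP/idP => [[y /mem_cube0 yt ->]|/mem_cube0 xt].
  by apply/mem_cube0; apply: supported_belowD.
by exists (x + u); rewrite ?addG2K //; apply/mem_cube0; apply: supported_belowD.
Qed.

Lemma count_cube_split t d (A : pred G2) :
  count A (cube 0 (t + d)) =
  (\sum_(b <- cube t d) count (fun x => A (x + b)%R) (cube 0 t))%N.
Proof.
elim: d A => [|d IH] A.
  by rewrite addn0 /= big_seq1; apply: eq_count => x; rewrite addr0.
rewrite addnS /= add0n count_cat big_cat count_map big_map IH /=; congr addn.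
by rewrite IH; apply: eq_bigr => b _; apply: eq_count => x; rewrite /= addrA.
Qed.

Definition weight t d x := count (bit^~ x) (iota t d).

Lemma weightS t d x : weight t d.+1 x = (weight t d x + bit (t + d) x)%N.
Proof. by rewrite /weight -addn1 iotaD count_cat /= addn0. Qed.

Lemma eq_weight t d x y :
    (forall i, (t <= i < t + d)%N -> bit i x = bit i y) ->
  weight t d x = weight t d y.
Proof. by move=> xy; apply: eq_in_count => i; rewrite mem_iota => /xy. Qed.

Lemma weight_addl t d x y : supported_below t x -> weight t d (x + y) = weight t d y.
Proof. by move=> xt; apply: eq_weight => i /andP[ti _]; rewrite bitD xt. Qed.

(** In each coordinate, none or exactly two of [x], [y], [x + y] have a one. If [y] has weight at
    least [d - k], the weights of [x] and [x + y] thus sum to a number within [k] of [d]. *)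
Lemma weight_add_bounds t d x y :
  (weight t d y <= weight t d x + weight t d (x + y))%N /\
  (weight t d x + weight t d y + weight t d (x + y) <= d.*2)%N.
Proof.
elim: d => [|d IH] //; rewrite !weightS bitD.
by case: (bit _ x) (bit _ y) => [] []; rewrite /=; lia.
Qed.

Lemma weight_indicator t d s :
  uniq s -> {subset s <= iota t d} -> weight t d (indicator s) = size s.
Proof.
move=> us sd; rewrite /weight -size_filter; apply: perm_size.
apply: uniq_perm; rewrite ?filter_uniq ?iota_uniq // => i.
by rewrite mem_filter bit_indicator // andb_idr //; apply: sd.
Qed.

Lemma count_weight t d w : count (fun x => weight t d x == w) (cube t d) = 'C(d, w).
Proof.
elim: d w => [|d IH] w; first by rewrite /= /weight /= addn0; case: w.
have below x : x \in cube t d -> bit (t + d) x = false.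
  by move/mem_cube => xd; apply/negbTE/negP => /xd; lia.
have wlow x : x \in cube t d -> weight t d.+1 x = weight t d x.
  by move=> xd; rewrite weightS below // addn0.
have whigh x : x \in cube t d -> weight t d.+1 (x + basis (t + d)) = (weight t d x).+1.
  move=> xd; rewrite weightS bitD below // bit_basis eqxx /= addn1; congr _.+1.
  by apply: eq_weight => i; rewrite bitD bit_basis; case: eqP => [|_]; rewrite ?addbF //; lia.
rewrite /= count_cat count_map.
rewrite (@eq_in_count _ _ (fun x => weight t d x == w)) => [|x xd]; last by rewrite wlow.
rewrite [X in (_ + X)%N](@eq_in_count _ _ (fun x => (weight t d x).+1 == w))
  => [|x xd]; last by rewrite /= whigh.
rewrite IH; case: w => [|w]; first by rewrite !bin0 (@eq_count _ _ pred0) // count_pred0.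
by rewrite binS -IH -[X in (_ = _ + X)%N]IH.
Qed.

Lemma count_weight_pred t d (P : pred nat) :
  count (fun x => P (weight t d x)) (cube t d) = (\sum_(w < d.+1 | P w) 'C(d, w))%N.
Proof.
under eq_bigr => w _ do rewrite -(count_weight t).
elim: (cube t d) => [|x s IH] /=; first by rewrite big1.
rewrite big_split -IH /=; congr addn.
have xd : (weight t d x < d.+1)%N.
  by rewrite ltnS -[X in (_ <= X)%N](size_iota t) count_size.
rewrite big_mkcond (bigD1 (Ordinal xd)) //= eqxx big1 ?addn0; first by case: (P _).
by move=> w /negP wx; case: eqP => [e|]; rewrite ?if_same //; case: wx; apply/eqP/val_inj.
Qed.

(** * Twisting a set by majority values *)

Definition cylinder s (A : pred G2) :=
  forall x y, (forall i, (i < s)%N -> bit i x = bit i y) -> A x = A y.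

Lemma cylinder_addl s A x y : cylinder s A ->
  (forall i, (i < s)%N -> bit i y = false) -> A (x + y) = A x.
Proof. by move=> As ys; apply: As => i si; rewrite bitD ys // addbF. Qed.

Definition avoids (A : pred G2) e := forall x, A x -> ~~ A (x + e).

(* The set [A] is transported to [A] or [A + u] according to the majority value
   on the block [t, ..., t + d - 1], and discarded near a tie. *)
Definition twist (A : pred G2) u t d k : pred G2 := fun x =>
  ((weight t d x).*2 + k < d)%N && A x ||
  (d + k < (weight t d x).*2)%N && A (x + u).

Section Twist.
Variables (A : pred G2) (u : G2) (s t d k : nat).

(** [x] and [x + e] agree on the block, so both fall under the same translate of [A]. *)
Lemma twist_avoids e : avoids A e -> (forall i, (t <= i < t + d)%N -> bit i e = false) ->
  avoids (twist A u t d k) e.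
Proof.
move=> Ae et x; rewrite /twist [weight t d (x + e)](@eq_weight _ _ _ x); last first.
  by move=> i /et; rewrite bitD => ->; rewrite addbF.
rewrite addrAC => /orP[/andP[lo /Ae/negPf ->]|/andP[hi /Ae/negPf ->]].
  by rewrite andbF /= negb_and -leqNgt; apply/orP; left; lia.
by rewrite andbF orbF negb_and -leqNgt; apply/orP; left; lia.
Qed.

Hypotheses (As : cylinder s A) (st : (s <= t)%N).

Lemma twist_cylinder : cylinder (t + d) (twist A u t d k).
Proof.
move=> x y xy; rewrite /twist (@eq_weight t d x y) => [|i ?]; last by apply: xy; lia.
rewrite (As (y := y)) => [|i ?]; last by apply: xy; lia.
by rewrite (As (x := x + u) (y := y + u)) // => i ?; rewrite !bitD xy //; lia.
Qed.

(** By [weight_add_bounds], [x] and [x + g + e] cannot have the same clear majority. So one is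
    tested in [A] and the other after adding [u]; as [A] does not see [e], the tested points differ
    by [e0]. *)
Lemma twist_avoids_block e0 g e :
    avoids A e0 -> supported_below t g -> u = g + e0 ->
    (forall i, (i < t)%N -> bit i e = false) -> (d <= weight t d e + k)%N ->
  avoids (twist A u t d k) (g + e).
Proof.
move=> Ae0 gt ue et de x.
have wE : weight t d (x + (g + e)) = weight t d (x + e).
  by rewrite addrCA (weight_addl _ _ gt).
have es i : (i < s)%N -> bit i e = false by move=> si; apply: et; lia.
have [w1 w2] := weight_add_bounds t d x e.
rewrite /twist wE => /orP[/andP[lo Ax]|/andP[hi Ax]].
  have -> /= : ((weight t d (x + e)).*2 + k < d)%N = false by lia.
  have -> : x + (g + e) + u = x + e0 + e.
    apply: bit_inj => i; rewrite ue !bitD.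
    by case: (bit i x) (bit i g) (bit i e) (bit i e0) => [] [] [] [].
  by rewrite (cylinder_addl _ As es) negb_and Ae0 ?orbT.
have -> /= : (d + k < (weight t d (x + e)).*2)%N = false by lia.
rewrite orbF addrA (cylinder_addl _ As es) negb_and; apply/orP; right.
by have := Ae0 _ Ax; rewrite ue addrA addG2K.
Qed.

(** Over each block value [b] away from a tie, the fibre is [A] or its translate by [u], of equal
    size. *)
Lemma count_twist : supported_below t u ->
  count (twist A u t d k) (cube 0 (t + d)) =
  (count (fun b => ((weight t d b).*2 + k < d) || (d + k < (weight t d b).*2)) (cube t d)
   * count A (cube 0 t))%N.
Proof.
move=> ut; rewrite count_cube_split -sum1_count big_distrl [RHS]big_mkcond /=.
rewrite !big_seq; apply: eq_bigr => b /mem_cube bt.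
have bs i : (i < s)%N -> bit i b = false by move=> si; apply/negbTE/negP => /bt; lia.
have -> : count (fun x => twist A u t d k (x + b)) (cube 0 t) =
    count (fun x => ((weight t d b).*2 + k < d)%N && A x ||
                    (d + k < (weight t d b).*2)%N && A (x + u)) (cube 0 t).
  apply: eq_in_count => x /mem_cube0 xt; rewrite /twist weight_addl //.
  by rewrite addrAC !(cylinder_addl _ As bs).
case: ltnP => lo /=; rewrite ?mul1n.
  apply: eq_count => x; case: ltnP => hi; [lia | by rewrite orbF].
by case: ltnP => _ /=; rewrite ?mul1n ?count_cube_translate // count_pred0.
Qed.

End Twist.

(** * The iterated construction *)

Section Density.
Variable R : realType.
Implicit Types (A : pred G2) (u : G2).

Definition density A t : R := (count A (cube 0 t))%:R / 2 ^+ t.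

Lemma pow2_gt0 n : 0 < 2 ^+ n :> R.
Proof. exact: exprn_gt0. Qed.

Lemma density_le1 A t : density A t <= 1.
Proof.
rewrite ler_pdivrMr ?pow2_gt0 // mul1r -natrX ler_nat -(size_cube 0).
exact: count_size.
Qed.

Lemma density_cylinder A s t : cylinder s A -> (s <= t)%N -> density A t = density A s.
Proof.
move=> As /subnKC <-; move: (t - s)%N => d; rewrite /density.
suff -> : count A (cube 0 (s + d)) = (2 ^ d * count A (cube 0 s))%N.
  by rewrite natrM natrX exprD [2 ^+ s * _]mulrC -mulf_div divff ?mul1r // gt_eqF ?pow2_gt0.
rewrite count_cube_split -(size_cube s) -sum1_size big_distrl /= !big_seq.
apply: eq_bigr => b /mem_cube bs; rewrite mul1n; apply: eq_count => x.
by apply: cylinder_addl As _ => i si; apply/negbTE/negP => /bs; lia.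
Qed.

(** The density is multiplied by the proportion of blocks away from a tie; since it is at most 1,
    the loss is at most [delta]. *)
Lemma density_twist A u s t d k delta :
    cylinder s A -> (s <= t)%N -> supported_below t u ->
    (\sum_(w < d.+1 | (d <= w.*2 + k)%N && (w.*2 <= d + k)%N) 'C(d, w))%:R
      <= delta * 2 ^+ d ->
  density A t - delta <= density (twist A u t d k) (t + d).
Proof.
move=> As st ut mid.
rewrite {2}/density (count_twist _ _ As st ut).
set c := count _ (cube t d); set m := (\sum_(_ < _ | _) _)%N in mid.
have cm : (c + m = 2 ^ d)%N.
  rewrite -(size_cube t) /m.
  rewrite -(count_weight_pred t d (fun w => (d <= w.*2 + k)%N && (w.*2 <= d + k)%N)).
  rewrite -(count_predC (fun b => ((weight t d b).*2 + k < d)%N ||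
                                  (d + k < (weight t d b).*2)%N)).
  by congr addn; apply: eq_count => x /=; rewrite negb_or -!leqNgt.
have -> : (c * count A (cube 0 t))%:R / 2 ^+ (t + d) = (1 - m%:R / 2 ^+ d) * density A t.
  have -> : 1 - m%:R / 2 ^+ d = c%:R / 2 ^+ d :> R.
    apply: (canRL (mulfK _)); rewrite ?gt_eqF ?pow2_gt0 //
      mulrBl mul1r divfK ?gt_eqF ?pow2_gt0 //.
    by rewrite -natrX -cm natrD addrK.
  by rewrite natrM exprD [2 ^+ t * _]mulrC -mulf_div.
have mid' : m%:R / 2 ^+ d <= delta by rewrite ler_pdivrMr ?pow2_gt0.
have m0 : 0 <= m%:R / 2 ^+ d :> R by rewrite divr_ge0 ?ler0n // ltW ?pow2_gt0.
have := density_le1 A t; move: (density A t) (_ / _) mid' m0 => a b; nra.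
Qed.

End Density.

Section Stages.
Variables (gs : nat -> seq nat) (ks ds : nat -> nat).

Definition bound (s : seq nat) := (\max_(i <- s) i.+1)%N.

Lemma supported_bound s : supported_below (bound s) (indicator s).
Proof.
move=> i; rewrite /bound /indicator; elim: s => [|j s IH]; first by rewrite !big_nil bit0.
rewrite !big_cons geq_max => /andP[ji si]; rewrite bitD IH // bit_basis.
by rewrite gtn_eqF.
Qed.

(** The number of coordinates that stage [j] may read, 1 at the start because of coordinate 0. The
    maximum puts the next block beyond the support of the shift as well. *)
Fixpoint level j :=
  if j is i.+1 then (maxn (level i) (bound (gs i)) + ds i)%N else 1%N.

Definition offset j := maxn (level j) (bound (gs j)).

Fixpoint stage j : pred G2 :=
  if j is i.+1 then
    twist (stage i) (indicator (gs i) + basis 0) (offset i) (ds i) (ks i)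
  else fun x => ~~ bit 0 x.

Lemma level_gt0 j : (0 < level j)%N.
Proof. by elim: j => //= j IH; lia. Qed.

Lemma supported_offset j : supported_below (offset j) (indicator (gs j)).
Proof. exact: (supported_belowW (leq_maxr _ _) (@supported_bound _)). Qed.

Lemma supported_shift j : supported_below (offset j) (indicator (gs j) + basis 0).
Proof.
apply: supported_belowD (@supported_offset j) _ => i ji; rewrite bit_basis gtn_eqF //.
by apply: leq_trans ji; rewrite /offset; have := level_gt0 j; lia.
Qed.

Lemma level_offset j : (level j <= offset j)%N.
Proof. exact: leq_maxl. Qed.

Lemma levelS j : level j.+1 = (offset j + ds j)%N.
Proof. by []. Qed.

Lemma level_mono : {homo level : i j / (i <= j)%N}.
Proof.
apply: homo_leq => [//|i j k|i]; first exact: leq_trans.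
by rewrite levelS (leq_trans (level_offset i)) // leq_addr.
Qed.

Lemma stage_cylinder j : cylinder (level j) (stage j).
Proof.
elim: j => [|j IH]; first by move=> x y /= ->.
exact: (twist_cylinder _ _ IH (level_offset j)).
Qed.

Lemma stage_avoids_basis j : avoids (stage j) (basis 0).
Proof.
elim: j => [|j IH] /=.
  by move=> x; rewrite bitD bit_basis addbT negbK => /negPf ->.
apply: twist_avoids => // i; rewrite bit_basis.
by have := level_gt0 j; have := level_offset j; lia.
Qed.

(** The twist at step [j] creates the avoidance; later blocks lie above the support of the
    difference, so it survives. *)
Lemma stage_avoids j n e : (j < n)%N ->
    (forall i, bit i e -> (offset j <= i < offset j + ds j)%N) ->
    (ds j <= weight (offset j) (ds j) e + ks j)%N ->
  avoids (stage n) (indicator (gs j) + e).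
Proof.
move=> + ej we; have outside i : (i < offset j)%N -> bit i e = false.
  by move=> ij; apply/negbTE/negP => /ej; lia.
elim: n => // n IH; rewrite ltnS leq_eqVlt => /predU1P[<-|jn] /=.
  exact: (twist_avoids_block (@stage_cylinder j) (level_offset j)
    (@stage_avoids_basis j) (@supported_offset j) erefl outside we).
apply: twist_avoids; first exact: IH.
have := level_mono jn; have := level_offset n; rewrite levelS => on jn' i oi.
rewrite bitD supported_offset; last lia.
by apply/negbTE/negP => /ej; lia.
Qed.

(** Such an [x] vanishes on all later blocks, where [ks l < ds l] makes 0 a clear majority. *)
Lemma stage_stable i j x : (forall l, (ks l < ds l)%N) -> (i <= j)%N ->
  supported_below (level i) x -> stage j x = stage i x.
Proof.
move=> kd + xi; elim: j => [|j IH]; first by rewrite leqn0 => /eqP ->.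
rewrite leq_eqVlt => /predU1P[->|] //; rewrite ltnS => ij; rewrite -(IH ij) /=.
have w0 : weight (offset j) (ds j) x = 0%N.
  rewrite (@eq_weight _ _ _ 0) => [|l /andP[jl _]]; last first.
    by rewrite bit0 xi //; have := level_mono ij; have := level_offset j; lia.
  by rewrite /weight (@eq_count _ _ pred0) ?count_pred0 // => l; rewrite bit0.
by rewrite /twist w0 double0 add0n kd ltn0 orbF.
Qed.

Lemma level_ge j : (forall l, (ks l < ds l)%N) -> (j <= level j)%N.
Proof.
move=> kd; elim: j => // j IH; rewrite levelS.
by have := level_offset j; have := kd j; lia.
Qed.

(** The losses form a geometric series of sum [eta]; the term [eta / 2 ^+ j] is the part not yet
    spent. *)
Lemma stage_density (R : realType) (eta : R) j :
    (forall l, (\sum_(w < (ds l).+1 | (ds l <= w.*2 + ks l)%N &&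
        (w.*2 <= ds l + ks l)%N) 'C(ds l, w))%:R <= eta / 2 ^+ l.+1 * 2 ^+ ds l) ->
  2^-1 - eta + eta / 2 ^+ j <= density R (stage j) (level j).
Proof.
move=> mid; elim: j => [|j IH].
  rewrite /density /= !(bitD, bit0, bit_basis) /= expr0 expr1 divr1.
  by rewrite subrK div1r.
have := density_twist (@stage_cylinder j) (level_offset j) (@supported_shift j) (mid j).
apply: le_trans; rewrite (density_cylinder _ (@stage_cylinder j) (level_offset j)).
apply: le_trans (lerB IH (lexx _)); rewrite exprS invfM.
by move: (2 ^+ j)^-1 => y; lra.
Qed.

End Stages.

(** * Cubes as a Følner sequence, and the conclusion *)

Lemma card_fset_count (T : choiceType) (s : seq T) (P : pred T) : uniq s ->
  #|` [fset x in [fset y in s] | P x]%fset| = count P s.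
Proof.
move=> us; rewrite -size_filter; apply: perm_size; apply: uniq_perm.
- exact: fset_uniq.
- by rewrite filter_uniq.
- by move=> x; rewrite !inE mem_filter andbC.
Qed.

Definition cube_fset n : {fset G2} := [fset x in cube 0 n]%fset.

Lemma card_cube_fset n : #|` cube_fset n| = (2 ^ n)%N.
Proof.
rewrite -(size_cube 0); apply: perm_size; apply: uniq_perm.
- exact: fset_uniq.
- exact: cube_uniq.
- by move=> x; rewrite !inE.
Qed.

Lemma ftranslate_cube n g : supported_below n g -> ftranslate (cube_fset n) g = cube_fset n.
Proof.
move=> gn; apply/fsetP => x; apply/imfsetP/idP => [[y /= + ->]|].
  by rewrite !inE => /mem_cube0 yn; apply/mem_cube0; apply: supported_belowD.
rewrite !inE => /mem_cube0 xn; exists (x + g); last by rewrite addG2K.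
by rewrite /= !inE; apply/mem_cube0; apply: supported_belowD.
Qed.

(** Each [g] has finite support, so it eventually lies in the cube, a subgroup, and the ratio is
    exactly 1. *)
Lemma folner_cube (R : realType) (l : nat -> nat) :
  (forall n, (n <= l n)%N) -> folner R (fun n => cube_fset (l n)).
Proof.
move=> ln; split=> [n|g]; first by rewrite -cardfs_gt0 card_cube_fset expn_gt0.
apply: cvg_near_cst; have [s _ gs] := indicatorP g.
exists (bound s) => // n /= sn.
rewrite ftranslate_cube ?fsetIid ?divff // ?card_cube_fset ?pnatr_eq0 -?lt0n ?expn_gt0 //.
by rewrite gs; exact: (supported_belowW (leq_trans sn (ln n)) (@supported_bound s)).
Qed.

Lemma le_limn_esup (R : realType) (u : nat -> \bar R) (c : \bar R) :
  (forall n, c <= u n)%E -> (c <= limn_esup u)%E.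
Proof.
move=> cu; rewrite limn_esup_lim; apply: lime_ge; first exact: is_cvg_esups.
apply: nearW => n; apply: le_trans (cu n) _.
by apply: ereal_sup_ubound; exists n => /=.
Qed.

(* Kneser's theorem, applied to the colouring of the block by the translates of
   the syndetic set. *)
Lemma piecewise_syndetic_block (B : set G2) : piecewise_syndetic B ->
  exists k, forall t d, exists e, [/\ diffset B B e,
    (forall i, bit i e -> (t <= i < t + d)%N) & (d <= weight t d e + k)%N].
Proof.
case=> S [[F SF] SB]; exists #|` F| => t d.
have cover x : exists2 f, f \in F & S (x - f).
  have : sumset S [set` F]%classic x by rewrite SF.
  by case=> a Sa [f fF <-]; exists f => //; rewrite addrK.
pose shiftv (v : seq nat) := indicator [seq (t + i)%N | i <- v].
have /choice[f fP] : forall v, exists f, f \in F /\ S (shiftv v - f).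
  by move=> v; have [f fF Sf] := cover (shiftv v); exists f.
pose c v := index (f v) F.
have ck v : (c v < #|` F|)%N by rewrite index_mem; case: (fP v).
have [u [v [uI vI uv duv cuv]]] := generalized_Kneser d ck.
have fuv : f u = f v.
  have [[fu _] [fv _]] := (fP u, fP v); exact: (index_inj (f u) fu fv cuv).
have uniqI w : subseq w (rev (iota 0 d)) -> uniq w.
  by move/subseq_uniq; apply; rewrite rev_uniq iota_uniq.
have addI' : injective (addn t) by move=> i j; apply: addnI.
pose w := [seq (t + i)%N | i <- u ++ v].
have uw : uniq w.
  by rewrite (map_inj_uniq addI') cat_uniq (uniqI _ uI) (uniqI _ vI) andbT.
have wI : {subset w <= iota t d}.
  move=> _ /mapP[i + ->]; rewrite mem_cat mem_iota => /orP[/(mem_subseq uI)|/(mem_subseq vI)];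
  by rewrite mem_rev mem_iota; lia.
exists (indicator w); split.
- have [[_ Su] [_ Sv]] := (fP u, fP v).
  (* Two points of [S] suffice as a pattern; the common [f u = f v] and the shift [g] cancel in the
     difference. *)
  have [|g gP] := SB [fset shiftv u - f u; shiftv v - f v]%fset.
    by move=> x /fset2P[] ->.
  exists (shiftv u - f u + g).
    by apply: gP; exists (shiftv u - f u); [exact: fset21|].
  exists (shiftv v - f v + g).
    by apply: gP; exists (shiftv v - f v); [exact: fset22|].
  rewrite fuv [indicator w](_ : _ = shiftv u + shiftv v).
    apply: bit_inj => i; rewrite !subG2 !bitD.
    by case: (bit i (shiftv u)) (bit i (shiftv v)) (bit i g) (bit i (f v)) => [] [] [] [].
  by rewrite /indicator /w map_cat big_cat.
- by move=> i; rewrite (bit_indicator _ uw) => /wI; rewrite mem_iota.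
- by rewrite (weight_indicator uw wI) size_map size_cat.
Qed.

Theorem theorem1p2 (R : realType) (eps : R) (heps : 0 < eps) :
  exists A : set G2,
    ((2^-1 - eps)%:E < upper_Banach_density R A)%E /\
    ~ (exists (B : set G2) (g : G2),
         piecewise_syndetic B /\
         translate (diffset B B) g `<=` diffset A A).
Proof.
pose eta := eps / 2.
have eta0 : 0 < eta by rewrite /eta; lra.
(* Every pair of a finite support and a [k] occurs at its code; other indices get a harmless
   default. *)
pose gs j := (odflt ([::] : seq nat, 0%N) (choice.unpickle j)).1.
pose ks j := (odflt ([::] : seq nat, 0%N) (choice.unpickle j)).2.
have /choice[ds dsP] : forall j, exists d, (ks j < d)%N /\
    (\sum_(w < d.+1 | (d <= w.*2 + ks j)%N && (w.*2 <= d + ks j)%N) 'C(d, w))%:R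
      <= eta / 2 ^+ j.+1 * 2 ^+ d :> R.
  move=> j; have [|d kd mid] := @middle_binomials R (ks j) (eta / 2 ^+ j.+1).
    by rewrite divr_gt0 ?pow2_gt0.
  by exists d.
have kd l : (ks l < ds l)%N by case: (dsP l).
(* The limit of the stages: by [stage_stable], membership of each point is eventually constant. *)
pose A : set G2 := [set x | exists J, forall j, (J <= j)%N -> stage gs ks ds j x].
exists A; split.
- have folA : folner R (fun n => cube_fset (level gs ds n)).
    by apply: folner_cube => n; apply: level_ge kd.
  apply: (@lt_le_trans _ _ (2^-1 - eta)%:E); first by rewrite lte_fin /eta; lra.
  apply: le_trans (ereal_sup_ubound (ex_intro2 _ _ _ folA erefl)).
  apply: le_limn_esup => n; rewrite lee_fin card_cube_fset natrX.
  apply: (@le_trans _ _ (2^-1 - eta + eta / 2 ^+ n)).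
    by rewrite lerDl divr_ge0 ?ltW ?pow2_gt0.
  apply: le_trans (stage_density gs n (fun l => (dsP l).2)) _.
  rewrite ler_pM2r ?invr_gt0 ?pow2_gt0 // ler_nat card_fset_count; last exact: cube_uniq.
  rewrite -!size_filter uniq_leq_size ?filter_uniq ?cube_uniq // => x.
  rewrite !mem_filter => /andP[xn xc]; rewrite xc andbT; apply/mem_set.
  exists n => j nj; rewrite (stage_stable kd nj) //; exact/mem_cube0.
- case=> B [g [/piecewise_syndetic_block[k block] sub]].
  (* The step [j] devoted to this translate [g] and this number [k] of colours. *)
  have [s _ gE] := indicatorP g; pose j := choice.pickle (s, k).
  have gj : gs j = s by rewrite /gs choice.pickleK.
  have kj : ks j = k by rewrite /ks choice.pickleK.
  have [e [eB ej we]] := block (offset gs ds j) (ds j).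
  have [|a [J1 aA] [b [J2 bA] abe]] := sub (e + g); first by exists e.
  (* A stage after step [j] that contains both [a] and [b]. *)
  pose n := maxn j.+1 (maxn J1 J2).
  have jn : (j < n)%N by rewrite leq_max leqnn.
  have := @stage_avoids gs ks ds j n e jn ej; rewrite kj => /(_ we b).
  have -> : b + (indicator (gs j) + e) = a by rewrite gj -gE [g + e]addrC -abe addrC subrK.
  by rewrite aA ?bA => [/(_ isT)||]; rewrite // /n !leq_max leqnn ?orbT.
Qed.
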